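(* For all integers $j\geq 2$ and $k\geq 7j^3$ such that $k+j$ is even, $\textsf{Max-CSP}(\textsf{WMON}_{k,j})$ is sketching approximable in $O(\log(n))$ space. In particular, for every $j\ge 2$ there exist infinitely many $k$ such that $\textsf{Max-CSP}(\textsf{WMON}_{k,j})$ is sketching approximable.
   Context: For $z\in\mathbb{R}$, $\textsf{sign}(z)=1$ if $z>0$ and $0$ otherwise. For integers $j$ and $k\ge2$, $\textsf{WMON}_{k,j}:\{-1,1\}^k\to\{0,1\}$ is $\textsf{WMON}_{k,j}(x_1,\dots,x_k)=\textsf{sign}(j\cdot x_1+\sum_{i=2}^k x_i)$. For $f:\{-1,1\}^k\to\{0,1\}$, an instance $\Psi$ of $\textsf{Max-CSP}(f)$ on Boolean variables $X_1,\dots,X_n\in\{-1,1\}$ consists of $m$ constraints, each applying $f$ to a sequence of $k$ literals on $k$ distinct variables (a literal being $X_j$ or $-X_j$); $\textsf{val}_\Psi$ is the maximum over assignments of the fraction of satisfied constraints. Let $\rho(f)=2^{-k}|f^{-1}(1)|$. For $0\le\beta<\gamma\le1$, $(\gamma,\beta)$-$\textsf{Max-CSP}(f)$ is the promise problem of deciding, given $\Psi$ with $\textsf{val}_\Psi\ge\gamma$ or $\textsf{val}_\Psi<\beta$, which holds. Inputs arrive as a stream of constraints; a sketching algorithm is a randomized streaming algorithm using space $s(n)$ whose state (sketch) is composable: for fixed randomness, the sketch of a concatenation of two streams is determined by the sketches of the two streams. It solves a problem if it answers correctly with probability at least $2/3$ on every input. $\textsf{Max-CSP}(f)$ is sketching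 approximable in space $s(n)$ if there exist $\epsilon>0$ and a sketching algorithm using space $s(n)$ solving $(1-\epsilon,\rho(f)+\epsilon)$-$\textsf{Max-CSP}(f)$.
   Formalization: The number m of constraints is assumed to satisfy 1 ≤ m ≤ n^d, for every fixed exponent d (ε independent of d, the O(log n) constant may depend on d); with streams of unbounded length the claim is false, since a composable sketch of s(n) bits takes finitely many values. *)

(* Defs.v *)
From mathcomp Require Import all_boot all_order all_algebra.
From mathcomp Require Import all_classical all_reals all_analysis.
Set Implicit Arguments.
Unset Strict Implicit.
Unset Printing Implicit Defensive.
Import Order.TTheory GRing.Theory Num.Theory.
Import numFieldNormedType.Exports.
Local Open Scope classical_set_scope.
Local Open Scope ring_scope.

(* The set {-1, 1} is encoded by bool: b stands for (-1) ^+ b, so that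
   false is 1, true is -1, and negation of a literal is an exclusive or. *)
Definition pm1 (b : bool) : int := (-1) ^+ b.

Definition predicate (k : nat) := k.-tuple bool -> bool.

(* Coordinates are numbered from 0: the monarch x_1 is the entry of index 0. *)
Definition WMON (k : nat) (j : int) : predicate k := fun x =>
  0 < j * pm1 (nth false x 0) + \sum_(1 <= i < k) pm1 (nth false x i).
Arguments WMON k j x : clear implicits.

Definition rho (R : realType) (k : nat) (f : predicate k) : R :=
  #|[set x : k.-tuple bool | f x]|%:R / 2 ^+ k.

(* The literal (i, false) is X_i and the literal (i, true) is - X_i. *)
Definition literal (n : nat) : Type := ('I_n * bool)%type.

Definition constraint (k n : nat) : Type :=
  {c : k.-tuple ('I_n * bool) | uniq [seq l.1 | l <- c]}.

Definition instance (k n : nat) : Type := seq (constraint k n).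

Definition assignment (n : nat) : Type := n.-tuple bool.

Definition lit_val (n : nat) (a : n.-tuple bool) (l : literal n) : bool :=
  tnth a l.1 (+) l.2.

Definition satisfies (k n : nat) (f : predicate k) (a : assignment n)
    (c : constraint k n) : bool :=
  f (map_tuple (lit_val a) (val c)).

(* Meaningful only for a nonempty instance. *)
Definition csp_val (R : realType) (k n : nat) (f : predicate k)
    (Psi : instance k n) : R :=
  \big[Num.max/0]_(a : n.-tuple bool)
     ((count (satisfies f a) Psi)%:R / (size Psi)%:R).

(* A streaming algorithm for instances on n variables, with s bits of memory.
   The random coins are drawn uniformly, once and for all, and may be consulted
   at every step; they are not part of the memory. *)
Record streaming_alg (k n s : nat) := StreamingAlg {
  ncoins : nat ;
  init : ncoins.-tuple bool -> s.-tuple bool ;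
  step : ncoins.-tuple bool -> s.-tuple bool -> constraint k n -> s.-tuple bool ;
  answer : ncoins.-tuple bool -> s.-tuple bool -> bool
}.

Definition sketch (k n s : nat) (A : streaming_alg k n s)
    (r : (ncoins A).-tuple bool) (Psi : instance k n) : s.-tuple bool :=
  foldl (step r) (init r) Psi.

Definition composable (k n s : nat) (A : streaming_alg k n s) : Prop :=
  forall (r : (ncoins A).-tuple bool) (Psi1 Psi1' Psi2 Psi2' : instance k n),
    sketch r Psi1 = sketch r Psi1' -> sketch r Psi2 = sketch r Psi2' ->
    sketch r (Psi1 ++ Psi2) = sketch r (Psi1' ++ Psi2').

Definition prob_answer (R : realType) (k n s : nat) (A : streaming_alg k n s)
    (Psi : instance k n) (b : bool) : R :=
  #|[set r : (ncoins A).-tuple bool | answer r (sketch r Psi) == b]|%:R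
    / 2 ^+ ncoins A.

(* A solves (gamma, beta)-Max-CSP(f) on streams of 1 to m constraints. *)
Definition solves (R : realType) (k n s : nat) (A : streaming_alg k n s)
    (f : predicate k) (gamma beta : R) (m : nat) : Prop :=
  forall Psi : instance k n, (0 < size Psi <= m)%N ->
    (gamma <= csp_val R f Psi -> 2 / 3 <= prob_answer R A Psi true) /\
    (csp_val R f Psi < beta -> 2 / 3 <= prob_answer R A Psi false).

(* Max-CSP(f) is sketching approximable in some space s of the class S.
   A state of s(n) bits cannot handle streams of unbounded length (for fixed
   coins the composable sketch ranges in a finite monoid, so it sees only
   eventually periodic multiplicities).  As usual, the number of constraints is
   therefore polynomial in n; epsilon does not depend on the polynomial. *)
Definition sketching_approximable (R : realType) (k : nat) (f : predicate k)
    (S : set (nat -> nat)) : Prop :=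
  exists2 epsilon : R, 0 < epsilon /\ rho R f + epsilon < 1 - epsilon &
  forall d : nat, exists2 s : nat -> nat, S s &
  forall n : nat, exists2 A : streaming_alg k n (s n), composable A &
    solves A f (1 - epsilon) (rho R f + epsilon) (n ^ d).

Definition logspace (R : realType) : set (nat -> nat) :=
  [set s | (fun n => (s n)%:R : R^o) =O_\oo (fun n => ln n%:R : R^o)].

(* Main.v *)
Require Import Defs.
From mathcomp Require Import all_boot all_order all_algebra.
From mathcomp Require Import all_classical all_reals all_analysis.
From mathcomp Require Import ring lra zify.
Set Implicit Arguments.
Unset Strict Implicit.
Unset Printing Implicit Defensive.
Import Order.TTheory GRing.Theory Num.Theory.
Local Open Scope classical_set_scope.
Local Open Scope ring_scope.

(** The degree-one Fourier (Chow) coefficients [lam] of the predicate [f] decide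
    approximability.  Suppose every satisfying assignment [x] of [f] has
    [<lam, x> > 0].  For an instance with [m] constraints let [bias i] be the sum of
    the signed weights [lam_t] with which the variable [i] occurs; its l1-norm is the
    maximum over assignments of the sum of [<lam, literals>] over the constraints.
    - If almost all constraints can be satisfied, this norm is at least [m / 2].
    - Conversely, if some assignment [a] makes it larger than a small multiple of [m],
      then drawing each variable independently with a small bias [eta] towards [a]
      satisfies [rho m + eta 2^-k |bias|_1 - O(eta^2 m)] constraints on average.
    So it suffices to tell [|bias|_1 >= m / 2] from [|bias|_1 <= m / 2904].  This is done
    by one linear counter [Z = sum_i v_i U_i Y_i], [v = 88 bias], where [U_i] is uniform in
    [{-3, -1, 1, 3}] and [Y_i] has the heavy tail [P (Y >= t) ~ 1 / t]: if [|v|_1 >= 44 m],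
    then some [|v_i| Y_i >= m] with high probability and [U_i] then keeps [|Z| >= m];
    if [33 |v|_1 <= m], truncating [Y_i] at [m / |v_i|] and Chebyshev give [|Z| < m].
    For [WMON] the Chow coefficients are [(l0, l1, ..., l1)] where
    [(j - 1) l1 < l0 < (j + 1) l1], as central binomials are almost constant. *)

(** * Averages over finite functions and the multipliers [spread] *)

Lemma card_pred_sum (T : finType) (P : pred T) : (#|P| = \sum_x P x)%N.
Proof. by rewrite -sum1_card big_mkcond; apply: eq_bigr => x _; rewrite unfold_in; case: (P x). Qed.

Definition fupd (I : finType) (T : Type) (G : {ffun I -> T}) (i : I) (x : T) :
  {ffun I -> T} := [ffun i' => if i' == i then x else G i'].

Lemma fupd_same (I : finType) (T : Type) (G : {ffun I -> T}) (i : I) (x : T) :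
  fupd G i x i = x.
Proof. by rewrite ffunE eqxx. Qed.

Lemma fupd_other (I : finType) (T : Type) (G : {ffun I -> T}) (i i' : I) (x : T) :
  i' != i -> fupd G i x i' = G i'.
Proof. by rewrite ffunE => /negbTE ->. Qed.

Lemma fupdK (I : finType) (T : Type) (G : {ffun I -> T}) (i : I) (x : T) :
  fupd (fupd G i x) i (G i) = G.
Proof. by apply/ffunP => i'; rewrite !ffunE; case: eqP => [->|]. Qed.

(** Under a uniform random function [G] the value [G i] is uniform: exchanging it with an
    independent fresh value is an involution of the pairs. *)
Lemma sum_ffun_marginal (V : nmodType) (I T : finType) (i : I) (h : T -> V) :
  (\sum_(G : {ffun I -> T}) h (G i)) *+ #|T|
  = (\sum_g h g) *+ #|{ffun I -> T}|.
Proof.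
pose swap (p : {ffun I -> T} * T) := (fupd p.1 i p.2, p.1 i).
have swapK : involutive swap.
  by case=> G g; rewrite /swap /= fupdK fupd_same.
transitivity (\sum_(p : {ffun I -> T} * T) h (p.1 i)).
  rewrite -(pair_bigA _ (fun (G : {ffun I -> T}) (_ : T) => h (G i))) /= -sumrMnl.
  by apply: eq_bigr => G _; rewrite sumr_const.
rewrite (reindex_inj (inv_inj swapK)) /=.
under eq_bigr do rewrite fupd_same.
rewrite -(pair_bigA _ (fun (_ : {ffun I -> T}) g => h g)) /=.
by rewrite sumr_const.
Qed.

(** Four values at mutual distance at least 2, rather than two signs: staying in a short interval
    then has probability at most 1/4 instead of 1/2, below the allowed 1/3. *)
Definition spread (u : 'I_4) : int := 2 * u%:Z - 3.

Lemma spread_rev u : spread (rev_ord u) = - spread u.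
Proof. by rewrite /spread; case: u => -[|[|[|[|]]]]. Qed.

Lemma sum_spread_sqr : \sum_u spread u ^+ 2 = 20.
Proof. by rewrite !big_ord_recl big_ord0. Qed.

(** Reversing the [i]-th multiplier negates every term. *)
Lemma sum_spread_cross (I : finType) (i i' : I) : i != i' ->
  \sum_(U : {ffun I -> 'I_4}) spread (U i) * spread (U i') = 0.
Proof.
move=> ii'.
have flipK : involutive (fun U : {ffun I -> 'I_4} => fupd U i (rev_ord (U i))).
  by move=> U; rewrite fupd_same rev_ordK fupdK.
set S := LHS; suff : S = - S by lia.
rewrite {1}/S (reindex_inj (inv_inj flipK)) /= -sumrN.
apply: eq_bigr => U _.
by rewrite fupd_same (fupd_other _ _ (i' := i')) 1?eq_sym// spread_rev mulNr.
Qed.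

(** Distinct multipliers are uncorrelated, so only the squares survive, each with mean 20 / 4 =
    5. *)
Lemma sum_spread_comb_sqr (I : finType) (a : I -> int) :
  \sum_(U : {ffun I -> 'I_4}) (\sum_i a i * spread (U i)) ^+ 2
  = (5 * \sum_i a i ^+ 2) *+ #|{ffun I -> 'I_4}|.
Proof.
transitivity (\sum_i \sum_i' a i * a i' *
    \sum_(U : {ffun I -> 'I_4}) spread (U i) * spread (U i')).
  under eq_bigr do rewrite expr2 mulr_suml.
  rewrite exchange_big; apply: eq_bigr => i _ /=.
  under eq_bigr do rewrite mulr_sumr.
  rewrite exchange_big; apply: eq_bigr => i' _ /=.
  by rewrite mulr_sumr; apply: eq_bigr => U _; ring.
rewrite mulr_sumr -sumrMnl; apply: eq_bigr => i _.
rewrite (bigD1 i) //= [X in _ + X]big1 ?addr0; last first.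
  by move=> i' ii'; rewrite sum_spread_cross ?mulr0 // eq_sym.
have := sum_ffun_marginal i (fun u => spread u ^+ 2).
rewrite sum_spread_sqr [#|'I_4|](card_ord 4).
have -> : \sum_(U : {ffun I -> 'I_4}) spread (U i) * spread (U i)
    = \sum_(U : {ffun I -> 'I_4}) spread (U i) ^+ 2 by [].
move: #|{ffun I -> 'I_4}| => n; set S := \sum_U _ => E.
have -> : S = 5 *+ n by move: E; rewrite -(mulr_natr 20) -(mulr_natr 5) -(mulr_natr S); lia.
by rewrite -mulrnAl -expr2 mulrC.
Qed.

(** * Heavy-tailed multipliers *)

Definition heavy (M : nat) (g : 'I_M) : nat := M %/ g.+1.

(** Both [t <= M %/ g.+1] and [g < M %/ t] say that [t * g.+1 <= M]. *)
Lemma card_heavy_ge (M t : nat) : (0 < t)%N ->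
  #|[pred g : 'I_M | (t <= heavy g)%N]| = (M %/ t)%N.
Proof.
move=> t0; have le : (M %/ t <= M)%N by exact: leq_div.
rewrite -[RHS]card_ord -(fintype.card_image (f := widen_ord le)); last first.
  by move=> x y /(congr1 val) /= /val_inj.
apply: eq_card => g; rewrite inE /heavy leq_divRL // mulnC -leq_divRL //.
apply/idP/fintype.imageP => [lt|[x _ ->] /=]; last exact: ltn_ord.
by exists (Ordinal lt) => //; exact: val_inj.
Qed.

(** Summation by layers: [minn y t ^ 2] is the sum of [2 * s + 1] over [s < t] with [s < y], and the
    tail count [M %/ s.+1] makes each layer contribute at most [2 * M]. *)
Lemma sum_minn_heavy_sqr (M t : nat) :
  (\sum_(g < M) minn (heavy g) t ^ 2 <= 2 * t * M)%N.
Proof.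
have minn_sqr y : (minn y t ^ 2 = \sum_(s < t) (2 * s + 1) * (s < y)%N)%N.
  elim: t => [|t IH]; first by rewrite minn0 big_ord0.
  by rewrite big_ord_recr /= -IH; case: ltnP; nia.
under eq_bigr do rewrite minn_sqr.
rewrite exchange_big /=.
have -> : (2 * t * M = \sum_(s < t) 2 * M)%N by rewrite sum_nat_const card_ord; nia.
apply: leq_sum => s _; rewrite -big_distrr /=.
have -> : (\sum_(g < M) (s < heavy g) = M %/ s.+1)%N.
  rewrite -card_heavy_ge // -sum1_card [RHS]big_mkcond /=.
  by apply: eq_bigr => g _; rewrite inE; case: ifP.
have := leq_trunc_div M s.+1; nia.
Qed.

(** Bounds the probability that none of several independent events occurs. The induction rests on (1
    - p) (1 + p + s) = 1 + s - p (p + s). *)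
Lemma prod_compl_le (F : realFieldType) (I : finType) (p : I -> F) :
  (forall i, 0 <= p i <= 1) ->
  (\prod_i (1 - p i)) * (1 + \sum_i p i) <= 1.
Proof.
move=> p01.
suff : 0 <= \sum_i p i /\ 0 <= \prod_i (1 - p i) /\
  (\prod_i (1 - p i)) * (1 + \sum_i p i) <= 1 by case=> _ [].
apply: (big_rec2 (fun s x => 0 <= s /\ 0 <= x /\ x * (1 + s) <= 1)).
  by rewrite addr0 mulr1.
move=> i s x _ [s0] [x0 xs]; have /andP[p0 p1] := p01 i.
split; first by rewrite addr_ge0.
split; first by rewrite mulr_ge0 // subr_ge0.
have : 0 <= x * p i * (p i + s) by rewrite !mulr_ge0 // addr_ge0.
nra.
Qed.

(* Once all the other multipliers are fixed, distinct values of the i-th one move the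
   sum by at least 2K, so at most one of the four keeps it in ]-K, K[. *)
Lemma card_small_spread_comb (I : finType) (a : I -> int) (i : I) (K : nat) :
  (K <= `|a i|)%N ->
  (4 * #|[pred U : {ffun I -> 'I_4} | (`|(\sum_i a i * spread (U i))%R| < K)%N]|
     <= #|{ffun I -> 'I_4}|)%N.
Proof.
move=> Kai; set S := [pred U | _].
pose upd (p : {ffun I -> 'I_4} * 'I_4) := fupd p.1 i p.2.
have upd_inj : {in [predX S & 'I_4] &, injective upd}.
  move=> [U u] [U' u'] /andP[/= SU _] /andP[/= SU' _] E.
  have off i' : i' != i -> U i' = U' i'.
    by move=> ii'; move/ffunP/(_ i'): E; rewrite !fupd_other.
  congr pair; last by move/ffunP/(_ i): E; rewrite !fupd_same.
  apply/ffunP => i'; case: (eqVneq i' i) => [->|/off//].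
  move: SU SU'; rewrite !inE (bigD1 i) //= [X in (_ -> (`|X| < _)%N -> _)](bigD1 i) //=.
  have -> : \sum_(i0 | i0 != i) a i0 * spread (U i0)
          = \sum_(i0 | i0 != i) a i0 * spread (U' i0).
    by apply: eq_bigr => i0 /off ->.
  set c := \sum_(_ | _) _ => SU SU'; apply/val_inj/eqP.
  move: SU SU'; rewrite /spread; case: eqP => // neq SU SU'.
  have : (2 * `|a i| <= `|(a i * (2 * (U i)%:Z - 3) - a i * (2 * (U' i)%:Z - 3))%R|)%N.
    have -> : a i * (2 * (U i)%:Z - 3) - a i * (2 * (U' i)%:Z - 3)
            = a i * (2 * ((U i)%:Z - (U' i)%:Z)) by ring.
    rewrite abszM mulnC leq_mul2l; apply/orP; right; move: neq => /=.
    by case: (nat_of_ord (U i)) (nat_of_ord (U' i)) => [|x] [|y]; lia.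
  by move: SU SU' Kai; lia.
rewrite mulnC -[X in (_ * X)%N](card_ord 4) -cardX -(card_in_imset upd_inj).
exact: max_card.
Qed.

(** * The randomized linear counter *)

Definition heavy_coef (I : finType) (M : nat) (w : {ffun I -> 'I_4} * {ffun I -> 'I_M})
    (i : I) : int :=
  spread (w.1 i) * (heavy (w.2 i))%:Z.

Lemma absz_heavy_coef (I : finType) (M : nat) (w : {ffun I -> 'I_4} * {ffun I -> 'I_M})
    (i : I) :
  (`|heavy_coef w i| <= 3 * M)%N.
Proof.
rewrite abszM leq_mul //; last exact: leq_div.
by rewrite /spread; case: (w.1 i) => -[|[|[|[|]]]].
Qed.

Definition heavy_sketch (I : finType) (M : nat) (v : I -> int)
    (w : {ffun I -> 'I_4} * {ffun I -> 'I_M}) : int :=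
  \sum_i v i * heavy_coef w i.

(** One coordinate of size [K] suffices, as [heavy] is never 0. Otherwise coordinate [i] reaches [K]
    with probability [c i / M], at least |v i| / (4 K); these add up to at least 44 / 4 = 11, and
    [prod_compl_le] yields 1 / 12. *)
Lemma card_no_large_coord (I : finType) (M : nat) (v : I -> int) (K : nat) :
  (0 < K <= M)%N -> (44 * K <= \sum_i `|v i|)%N ->
  (12 * #|[pred G : {ffun I -> 'I_M} | [forall i, (`|v i| * heavy (G i) < K)%N]]|
     <= #|{ffun I -> 'I_M}|)%N.
Proof.
move=> /andP[K0 KM] vK.
pose F i := [pred g : 'I_M | (`|v i| * heavy g < K)%N].
have M0 : (0 < M)%N by exact: leq_trans KM.
pose c i := #|predC (F i)|.
have cE i : (#|F i| + c i = M)%N by rewrite cardC card_ord.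
have prodE : #|[pred G : {ffun I -> 'I_M} | [forall i, (`|v i| * heavy (G i) < K)%N]]|
    = (\prod_i #|F i|)%N.
  rewrite (_ : #|_| = #|family F|); first by rewrite card_family foldrE big_image.
  by apply: eq_card => G; rewrite !inE.
rewrite prodE; have [/existsP[i Kvi]|/existsPn noK] :=
    boolP [exists i, (K <= `|v i|)%N].
  suff -> : (\prod_i #|F i| = 0)%N by [].
  apply/eqP; rewrite (bigD1 i) //= muln_eq0; apply/orP; left.
  apply/pred0P => g /=; apply/negbTE; rewrite -leqNgt.
  have : (0 < heavy g)%N by rewrite divn_gt0.
  by move: Kvi; nia.
have c_ge i : (M * `|v i| <= 4 * K * c i)%N.
  case: (posnP `|v i|) => [->|vi0]; first by rewrite muln0.
  have vK' := noK i; rewrite -ltnNge in vK'.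
  (* This is K / |v i| rounded up. Rounding costs a factor 2 here, since |v i| < K, and another 2 in
     [M %/ t], whence the 4. *)
  pose t := ((K.-1 %/ `|v i|).+1)%N.
  have tle : (t * `|v i| <= 2 * K)%N.
    by rewrite /t; have := leq_trunc_div K.-1 `|v i|; lia.
  have tM : (t <= M)%N by rewrite /t; have := leq_div K.-1 `|v i|; lia.
  have -> : c i = (M %/ t)%N.
    rewrite -card_heavy_ge //; apply: eq_card => g.
    rewrite !inE -leqNgt /t ltn_divLR // mulnC; lia.
  have : (M <= 2 * t * (M %/ t))%N.
    have := divn_eq M t; have := ltn_pmod M (isT : 0 < t)%N.
    have : (0 < M %/ t)%N by rewrite divn_gt0.
    by nia.
  by nia.
have : (M * \sum_i `|v i| <= 4 * K * \sum_i c i)%N.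
  by rewrite !big_distrr /=; apply: leq_sum.
move=> csum; have {}csum : (11 * M <= \sum_i c i)%N by nia.
have M0r : (0 : rat) < M%:R by rewrite ltr0n.
pose p (i : I) : rat := (c i)%:R / M%:R.
have p01 i : 0 <= p i <= 1.
  by rewrite divr_ge0 //= ler_pdivrMr // mul1r ler_nat -(cE i) leq_addl.
have := prod_compl_le p01; rewrite -mulr_suml -natr_sum.
have -> : \prod_i (1 - p i) = (\prod_i #|F i|)%:R / (M ^ #|I|)%:R :> rat.
  rewrite natrX -prodr_const natr_prod -prodf_div; apply: eq_bigr => i _.
  have -> : #|F i|%:R = M%:R - (c i)%:R :> rat by apply/(canRL (addrK _)); rewrite -natrD cE.
  by rewrite mulrBl divff // gt_eqF.
have s12 : 12 <= 1 + (\sum_i c i)%:R / M%:R :> rat.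
  rewrite -lerBlDl ler_pdivlMr //.
  have -> : 12 - 1 = 11%:R :> rat by ring.
  by rewrite -natrM ler_nat.
have N0 : (0 : rat) < (M ^ #|I|)%:R by rewrite ltr0n expn_gt0 M0.
rewrite card_ffun card_ord.
set P := (\prod_i _)%N; set s := 1 + _ in s12 *; set N := (M ^ _)%N in N0 *.
move=> le1; have : P%:R / N%:R * 12 <= 1 :> rat.
  by apply: le_trans le1; rewrite ler_wpM2l // divr_ge0.
by rewrite mulrAC ler_pdivrMr // mul1r -natrM ler_nat mulnC.
Qed.

Lemma sum_cards (T1 T2 : finType) (P : pred (T1 * T2)) :
  (#|P| = \sum_(y : T2) #|[pred x | P (x, y)]|)%N.
Proof.
transitivity (\sum_(x : T1) \sum_(y : T2) (if P (x, y) then 1 else 0))%N.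
  by rewrite pair_bigA -sum1_card big_mkcond; apply: eq_bigr => -[x y] _.
by rewrite exchange_big; apply: eq_bigr => y _; rewrite -sum1_card [RHS]big_mkcond.
Qed.

(** Given a large coordinate, the multipliers [U] fail with probability at most 1/4; having none has
    probability at most 1/12. In all 1/4 + 3/4 * 1/12 = 5/16 < 1/3. *)
Lemma heavy_sketch_large (I : finType) (M : nat) (v : I -> int) (K : nat) :
  (0 < K <= M)%N -> (44 * K <= \sum_i `|v i|)%N ->
  (3 * #|[pred w | (`|heavy_sketch (M := M) v w| < K)%N]|
     <= #|{: {ffun I -> 'I_4} * {ffun I -> 'I_M}}|)%N.
Proof.
move=> KM vK; rewrite sum_cards card_prod.
have := card_no_large_coord KM vK; set N := [pred G | _] => leN.
set A := #|{ffun I -> 'I_4}|; set B := #|{ffun I -> 'I_M}| in leN *.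
have : (4 * \sum_y #|[pred x | (`|heavy_sketch (M := M) v (x, y)| < K)%N]|
    <= \sum_y (A + (y \in N) * 3 * A))%N.
  rewrite big_distrr /=; apply: leq_sum => G _.
  have [NG|] := boolP (G \in N); first by rewrite -mulSn leq_mul ?max_card.
  rewrite inE negb_forall => /existsP[i]; rewrite -leqNgt => Ki.
  rewrite mul0n addn0.
  apply: leq_trans (card_small_spread_comb
    (a := fun i => v i * (heavy (G i))%:Z) (i := i) (K := K) _).
    rewrite leq_mul2l /=; apply: subset_leq_card; apply/fintype.subsetP => U.
    rewrite !inE /heavy_sketch /heavy_coef /=; congr (`|_| < _)%N.
    by apply: eq_bigr => i' _; rewrite mulrA mulrAC.
  by rewrite abszM.
have -> : (\sum_y (A + (y \in N) * 3 * A) = A * B + 3 * A * #|N|)%N.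
  rewrite big_split /= sum_nat_const mulnC; congr addn.
  have -> : #|N| = (\sum_y (y \in N))%N.
    by rewrite -sum1_card big_mkcond; apply: eq_bigr => y _; case: (y \in N).
  by rewrite big_distrr; apply: eq_bigr => y _ /=; rewrite -mulnA mulnC.
set X := (\sum_y _)%N.
nia.
Qed.

Lemma union_bound (T I : finType) (P : I -> pred T) :
  (#|[pred x | [exists i, P i x]]| <= \sum_i #|P i|)%N.
Proof.
rewrite card_pred_sum; under [leqRHS]eq_bigr do rewrite card_pred_sum.
rewrite exchange_big; apply: leq_sum => x _ /=.
by case: existsP => [[i Pi]|//]; rewrite (bigD1 i) //= Pi.
Qed.

Lemma sum_ffun_marginal_nat (I T : finType) (i : I) (h : T -> nat) :
  (#|T| * \sum_(G : {ffun I -> T}) h (G i) = #|{ffun I -> T}| * \sum_g h g)%N.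
Proof.
have := sum_ffun_marginal i h.
move: #|T| #|{ffun I -> T}| (\sum_G _) (\sum_g _) => p q x y.
have natrE (z w : nat) : z *+ w = (w * z)%N by rewrite -mulr_natl natn.
by rewrite !natrE.
Qed.

Lemma sum_spread_comb_sqr_nat (I : finType) (a : I -> int) :
  (\sum_(U : {ffun I -> 'I_4}) `|(\sum_i a i * spread (U i))%R| ^ 2
   = 5 * (\sum_i `|a i| ^ 2) * #|{ffun I -> 'I_4}|)%N.
Proof.
have sqE (z : int) : (`|z| ^ 2)%N%:Z = z ^+ 2.
  by rewrite -[RHS]ger0_norm ?sqr_ge0 // normrX -abszE; lia.
apply/eqP; rewrite -eqz_nat -!natz !natrM !natr_sum.
under eq_bigr do rewrite natz sqE.
rewrite sum_spread_comb_sqr -[X in X == _]mulr_natr; apply/eqP; congr (_ * _ * _).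
by apply: eq_bigr => i _; rewrite natz sqE.
Qed.

(** A union bound over tails of probability at most |v i| / K. Markov's inequality would lose a
    factor log M, the order of the mean of [heavy]. *)
Lemma card_large_coord (I : finType) (M : nat) (v : I -> int) (K : nat) : (0 < M)%N ->
  (K * #|[pred G : {ffun I -> 'I_M} | [exists i, (K < `|v i| * heavy (G i))%N]]|
     <= #|{ffun I -> 'I_M}| * \sum_i `|v i|)%N.
Proof.
move=> M0.
have := union_bound (fun i (G : {ffun I -> 'I_M}) => (K < `|v i| * heavy (G i))%N).
move/(leq_mul (leqnn K))/leq_trans; apply.
rewrite !big_distrr /=; apply: leq_sum => i _.
rewrite -(leq_pmul2l M0) mulnCA card_pred_sum.
have := sum_ffun_marginal_nat i (fun g : 'I_M => (K < `|v i| * heavy g)%N : nat).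
rewrite [#|'I_M|](card_ord M) => ->; rewrite mulnCA (mulnCA M) leq_mul2l.
apply/orP; right; rewrite -(card_pred_sum (fun g : 'I_M => (K < `|v i| * heavy g)%N)).
case: (posnP `|v i|) => [->|vi0].
  by rewrite eq_card0 ?muln0 // => g; rewrite inE mul0n.
have -> : #|fun g : 'I_M => (K < `|v i| * heavy g)%N| = (M %/ (K %/ `|v i|).+1)%N.
  rewrite -card_heavy_ge //; apply: eq_card => g.
  by rewrite !inE ltn_divLR // mulnC.
have := ltn_ceil K vi0; have := leq_trunc_div M (K %/ `|v i|).+1.
nia.
Qed.

(** With V = |v|_1, truncation changes the sum with probability at most V / K, and Chebyshev with
    second moment at most 5 * 2 K V adds 10 V / K; in all 11 V / K <= 1 / 3. *)
Lemma heavy_sketch_small (I : finType) (M : nat) (v : I -> int) (K : nat) :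
  (0 < M)%N -> (0 < K)%N -> (33 * (\sum_i `|v i|) <= K)%N ->
  (3 * #|[pred w | (K <= `|heavy_sketch (M := M) v w|)%N]|
     <= #|{: {ffun I -> 'I_4} * {ffun I -> 'I_M}}|)%N.
Proof.
move=> M0 K0 VK; rewrite card_prod.
set A := #|{ffun I -> 'I_4}|; set B := #|{ffun I -> 'I_M}|.
set V := (\sum_i `|v i|)%N in VK *.
(* Where [v i = 0] the division returns 0 and truncates everything, harmlessly, since that
   coordinate contributes nothing. *)
pose t i := (K %/ `|v i|)%N.
pose a (G : {ffun I -> 'I_M}) i := v i * (minn (heavy (G i)) (t i))%:Z.
pose large (G : {ffun I -> 'I_M}) := [exists i, (K < `|v i| * heavy (G i))%N].
pose Z' (U : {ffun I -> 'I_4}) G := \sum_i a G i * spread (U i).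
have split_bad (G : {ffun I -> 'I_M}) :
  (K * #|[pred U | (K <= `|heavy_sketch (M := M) v (U, G)|)%N]|
    * K <= K * A * (large G) * K + 5 * A * (\sum_i `|a G i| ^ 2))%N.
  have [_|/existsPn noL] := boolP (large G).
    by rewrite muln1 (leq_trans _ (leq_addr _ _)) // !leq_mul ?max_card.
  have -> : (5 * A * (\sum_i `|a G i| ^ 2) = \sum_U `|Z' U G| ^ 2)%N.
    by rewrite sum_spread_comb_sqr_nat mulnAC.
  rewrite muln0 mul0n add0n mulnAC card_pred_sum big_distrr.
  apply: leq_sum => U _ /=.
  have -> : heavy_sketch v (U, G) = Z' U G.
    apply: eq_bigr => i _; rewrite /a /heavy_coef /=.
    have -> : v i * (spread (U i) * (heavy (G i))%:Z)
            = v i * (heavy (G i))%:Z * spread (U i) by ring.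
    have [->|vi0] := eqVneq (v i) 0; first by rewrite !mul0r.
    have -> // : minn (heavy (G i)) (t i) = heavy (G i).
    apply/minn_idPl; rewrite /t leq_divRL ?absz_gt0 // mulnC.
    by have := noL i; rewrite -leqNgt.
  by case: leqP => // KZ; nia.
have sqr_bound : (\sum_(G : {ffun I -> 'I_M}) \sum_i `|a G i| ^ 2 <= 2 * K * B * V)%N.
  rewrite exchange_big big_distrr /=; apply: leq_sum => i _.
  under eq_bigr do rewrite abszM expnMn.
  rewrite -big_distrr /= -(leq_pmul2l M0) mulnCA.
  have := sum_ffun_marginal_nat i (fun g : 'I_M => minn (heavy g) (t i) ^ 2)%N.
  rewrite [#|'I_M|](card_ord M) => ->.
  have := sum_minn_heavy_sqr M (t i).
  have : (`|v i| * t i <= K)%N by rewrite mulnC leq_trunc_div.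
  rewrite -/B; set S := (\sum_g _)%N; set x := `|v i|%N; set y := t i => xy Sy.
  have : (x ^ 2 * (B * S) <= x ^ 2 * (B * (2 * y * M)))%N by rewrite !leq_mul.
  move/leq_trans; apply.
  have -> : (x ^ 2 * (B * (2 * y * M)) = 2 * M * B * x * (x * y))%N by lia.
  have : (2 * M * B * x * (x * y) <= 2 * M * B * x * K)%N by rewrite leq_mul2l xy orbT.
  by lia.
have := @card_large_coord I M v K M0; rewrite -/V -/B card_pred_sum -/large => largeB.
rewrite sum_cards.
set S := (\sum_y _)%N.
have : (K * S * K <= \sum_G (K * A * large G * K + 5 * A * \sum_i `|a G i| ^ 2))%N.
  by rewrite /S big_distrr big_distrl /=; apply: leq_sum => G _; exact: split_bad.
rewrite big_split /= -big_distrr -big_distrl -big_distrr /=.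
move: (\sum_G _)%N sqr_bound (\sum_i large i)%N largeB S => Q QB L LB S SQ.
have : (S * (K * K) <= 11 * A * B * V * K)%N.
  apply: (@leq_trans (K * L * (A * K) + 5 * A * Q)%N); first by lia.
  have : (K * L * (A * K) <= B * V * (A * K))%N by rewrite leq_mul.
  have : (5 * A * Q <= 5 * A * (2 * K * B * V))%N by rewrite leq_mul.
  by lia.
rewrite mulnA leq_pmul2r // => SK.
rewrite -(leq_pmul2r K0).
have : (A * B * (33 * V) <= A * B * K)%N by rewrite leq_mul.
by lia.
Qed.

(** * Linear sketches as streaming algorithms *)

Lemma card_classical_set (T : finType) (P : pred T) :
  #|[set x : T | P x]| = #|[pred x | P x]|.
Proof.
apply: eq_card => x; rewrite inE; apply/idP/idP; first by rewrite inE.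
by move=> Px; rewrite inE.
Qed.

Lemma eq_card_cancel (T1 T2 : finType) : #|T1| = #|T2| ->
  exists f : T1 -> T2, exists2 g, cancel f g & cancel g f.
Proof.
move=> E; exists (fun x => enum_val (cast_ord E (enum_rank x))).
exists (fun y => enum_val (cast_ord (esym E) (enum_rank y))) => x.
  by rewrite enum_valK cast_ordK enum_rankK.
by rewrite enum_valK cast_ordKV enum_rankK.
Qed.

Lemma card_pred_bij (T1 T2 : finType) (f : T1 -> T2) (P : pred T2) : bijective f ->
  #|[pred x | P (f x)]| = #|P|.
Proof. by move=> f_bij; rewrite !card_pred_sum (reindex f) //; exact: onW_bij. Qed.

(** The memory encodes a group element to which each constraint adds an increment. Concatenating
    streams adds these elements, and [e] is injective, hence composability. *)
Lemma linear_streaming_alg (R : realType) (k n s N : nat) (W : finType)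
    (G : zmodType) (e : G -> s.-tuple bool) (d : s.-tuple bool -> G)
    (phi : W -> constraint k n -> G) (ans : W -> G -> bool) :
  #|W| = (2 ^ N)%N -> cancel e d ->
  exists2 A : streaming_alg k n s, composable A &
    forall (Psi : instance k n) (b : bool), prob_answer R A Psi b
      = #|[pred w | ans w (\sum_(c <- Psi) phi w c) == b]|%:R / #|W|%:R.
Proof.
move=> cardW eK.
have [w [w' wK w'K]] : exists w : N.-tuple bool -> W, exists2 w', cancel w w' & cancel w' w.
  by apply: eq_card_cancel; rewrite card_tuple card_bool cardW.
pose A := @StreamingAlg k n s N (fun=> e 0) (fun r st c => e (d st + phi (w r) c))
  (fun r st => ans (w r) (d st)).
have sketchE r Psi : sketch (A := A) r Psi = e (\sum_(c <- Psi) phi (w r) c).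
  suff foldE g : foldl (@step k n s A r) (e g) Psi = e (g + \sum_(c <- Psi) phi (w r) c).
    by rewrite /sketch foldE add0r.
  elim: Psi g => [|c Psi IH] g /=; first by rewrite big_nil addr0.
  by rewrite eK IH big_cons addrA.
exists A => [r Psi1 Psi1' Psi2 Psi2'|Psi b].
  by rewrite !sketchE => /(can_inj eK) E1 /(can_inj eK) E2; rewrite !big_cat E1 E2.
rewrite /prob_answer card_classical_set cardW natrX; congr (_%:R / _).
have w_bij : bijective w by exists w'.
rewrite -(card_pred_bij [pred w | ans w (\sum_(c <- Psi) phi w c) == b] w_bij).
by apply: eq_card => r; rewrite !inE sketchE /= eK.
Qed.

(* Decides [m <= |z|] from the residues of [m] and [z] modulo [Q]. *)
Definition mod_test (Q : nat) (y : 'Z_Q * 'Z_Q) : bool :=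
  ~~ [exists t : 'I_Q, (t < y.1)%N && ((y.2 == t%:R) || (y.2 == - t%:R))].

Lemma Zp_intr_eq0 (Q : nat) (z : int) : (1 < Q)%N -> (`|z| < Q)%N ->
  z%:~R = 0 :> 'Z_Q -> z = 0.
Proof.
have nat_eq0 p : (p < Q)%N -> (1 < Q)%N -> p%:R = 0 :> 'Z_Q -> p = 0%N.
  by move=> pQ Q1 /(congr1 (@nat_of_ord _)); rewrite val_Zp_nat // modn_small.
case: z => p Q1 pQ; first by rewrite -pmulrn => /nat_eq0 ->.
rewrite NegzE mulrNz -pmulrn => /eqP; rewrite oppr_eq0 => /eqP.
by move/(nat_eq0 _ pQ Q1).
Qed.

(** No wrap-around: if t < m and z is congruent to t or -t, their difference is below [Q] in
    absolute value and must vanish. *)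
Lemma mod_testP (Q m : nat) (z : int) : (1 < Q)%N -> (`|z| + m <= Q)%N -> (m < Q)%N ->
  mod_test (m%:R, z%:~R : 'Z_Q) = (m <= `|z|)%N.
Proof.
move=> Q1 zQ mQ; rewrite leqNgt; congr negb.
apply/existsP/idP => [[t /=]|zm].
  rewrite val_Zp_nat // modn_small // => /andP[tm zt].
  have [->|->] : z = t%:Z \/ z = - t%:Z; last 2 first.
  - by [].
  - by rewrite abszN.
  case/orP: zt => /eqP zt; [left|right]; apply/eqP; rewrite -subr_eq0; apply/eqP;
    apply: (Zp_intr_eq0 Q1); first by lia.
  - by rewrite rmorphB /= zt -pmulrn subrr.
  - by lia.
  - by rewrite rmorphB /= zt rmorphN /= -pmulrn subrr.
have zQ' : (`|z| < Q)%N by lia.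
exists (Ordinal zQ') => /=; rewrite val_Zp_nat // modn_small // zm /=.
case: z zQ' {zQ zm} => p /= _; first by rewrite pmulrn eqxx.
by rewrite NegzE rmorphN /= pmulrn eqxx orbT.
Qed.

(** * The bias vector and the sketch of its norm *)

Definition bias (k n : nat) (lam : 'I_k -> int) (Psi : instance k n) (i : 'I_n) : int :=
  \sum_(c <- Psi) \sum_(t < k)
    if (tnth (val c) t).1 == i then lam t * pm1 (tnth (val c) t).2 else 0.

(** Regrouping by constraints makes the counter streamable: each increment involves only the
    variables of one constraint. *)
Lemma sum_bias (k n : nat) (lam : 'I_k -> int) (Psi : instance k n) (x : 'I_n -> int) :
  \sum_i bias lam Psi i * x i
  = \sum_(c <- Psi) \sum_(t < k) lam t * pm1 (tnth (val c) t).2 * x (tnth (val c) t).1.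
Proof.
under eq_bigr do rewrite mulr_suml.
rewrite exchange_big; apply: eq_bigr => c _ /=.
under eq_bigr do rewrite mulr_suml.
rewrite exchange_big; apply: eq_bigr => t _ /=.
rewrite (bigD1 (tnth (val c) t).1) //= eqxx big1 ?addr0 // => i.
by rewrite eq_sym => /negbTE ->; rewrite mul0r.
Qed.

Lemma absz_pm1 (b : bool) : `|pm1 b|%N = 1%N.
Proof. by case: b. Qed.

Lemma absz_sum (I : Type) (r : seq I) (x : I -> int) :
  (`|(\sum_(i <- r) x i)%R| <= \sum_(i <- r) `|x i|)%N.
Proof.
elim: r => [|i r IH]; first by rewrite !big_nil.
rewrite !big_cons; apply: leq_trans (leq_add (leqnn _) IH).
by move: (\sum_(j <- r) x j) (x i) => u y; lia.
Qed.

Lemma sum_abs_bias (k n : nat) (lam : 'I_k -> int) (Psi : instance k n) :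
  (\sum_i `|bias lam Psi i| <= (\sum_t `|lam t|) * size Psi)%N.
Proof.
apply: (@leq_trans (\sum_i \sum_(c <- Psi) \sum_(t < k)
    if (tnth (val c) t).1 == i then `|lam t| else 0)).
  apply: leq_sum => i _; apply: leq_trans (absz_sum _ _) _; apply: leq_sum => c _.
  apply: leq_trans (absz_sum _ _) _; apply: leq_sum => t _.
  by case: ifP; rewrite // abszM absz_pm1 muln1.
rewrite exchange_big /= -sum1_size big_distrr /=; apply: leq_sum => c _.
rewrite muln1 exchange_big; apply: leq_sum => t _ /=.
by rewrite -big_mkcond (big_pred1 (tnth (val c) t).1).
Qed.

(* Two counters modulo [2 ^ (c + 2 e)], where [n ^ d <= 2 ^ e]. *)
Definition sketch_bits (d c n : nat) : nat := (2 * (c + 2 * (d * (trunc_log 2 n).+1)))%N.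

(* The sketched vector is [88 bias], with 88 = 2 * 44 and 2904 = 88 * 33; its counter
   is at most [264 (sum_t |lam t|) m M] in absolute value, whence the choice of [c]. *)
Lemma gap_norm_sketch (R : realType) (k n d c : nat) (lam : 'I_k -> int) :
  (264 * (\sum_t `|lam t|) + 1 < 2 ^ c)%N ->
  exists2 A : streaming_alg k n (sketch_bits d c n), composable A &
    forall Psi : instance k n, (0 < size Psi <= n ^ d)%N ->
      ((size Psi <= 2 * \sum_i `|bias lam Psi i|)%N ->
        2 / 3 <= prob_answer R A Psi true) /\
      ((2904 * (\sum_i `|bias lam Psi i|) <= size Psi)%N ->
        2 / 3 <= prob_answer R A Psi false).
Proof.
set L := (\sum_t _)%N => Lc.
pose e := (d * (trunc_log 2 n).+1)%N; pose M := (2 ^ e)%N; pose Q := (2 ^ (c + 2 * e))%N.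
have QE : (Q = 2 ^ c * (M * M))%N by rewrite /Q /M expnD mul2n -addnn expnD.
have M0 : (0 < M)%N by rewrite expn_gt0.
have Q1 : (1 < Q)%N by rewrite QE; nia.
have nM : (n ^ d <= M)%N.
  rewrite /M /e mulnC expnM; case: (d) => // d'.
  by rewrite leq_exp2r // ltnW // trunc_log_ltn.
pose W := ({ffun 'I_n -> 'I_4} * {ffun 'I_n -> 'I_M})%type.
pose phi (w : W) (c : constraint k n) : 'Z_Q * 'Z_Q :=
  (1, (\sum_(t < k) 88 * (lam t * pm1 (tnth (val c) t).2 * heavy_coef w (tnth (val c) t).1))%:~R).
have [enc [dec encK _]] : exists enc : 'Z_Q * 'Z_Q -> (sketch_bits d c n).-tuple bool,
    exists2 dec, cancel enc dec & cancel dec enc.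
  apply: eq_card_cancel.
  by rewrite card_prod card_ord Zp_cast // -expnD addnn -mul2n card_tuple card_bool.
(* Two coins per variable for [spread] and [e] for [heavy]: as [M = 2 ^ e], both draws are exactly
   uniform. *)
have [|A Acomp Aprob] := @linear_streaming_alg R k n (sketch_bits d c n)
    (2 * n + e * n) W _ enc dec phi (fun _ => @mod_test Q) _ encK.
  by rewrite card_prod !card_ffun !card_ord expnD (expnM 2 2) (expnM 2 e).
exists A => // Psi /andP[m0 md].
pose v i := 88 * bias lam Psi i.
have normv : (\sum_i `|v i| = 88 * \sum_i `|bias lam Psi i|)%N.
  by rewrite big_distrr /=; apply: eq_bigr => i _; rewrite abszM.
have ansE w : mod_test (\sum_(c <- Psi) phi w c) = (size Psi <= `|heavy_sketch v w|)%N.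
  have -> : \sum_(c <- Psi) phi w c = ((size Psi)%:R, (heavy_sketch v w)%:~R).
    rewrite /heavy_sketch /v; under [in RHS]eq_bigr do rewrite -mulrA.
    rewrite -mulr_sumr (sum_bias lam Psi (heavy_coef w)) mulr_sumr rmorph_sum /=.
    rewrite [LHS]surjective_pairing.
    congr pair.
      by rewrite -[LHS]/(fst _) (big_morph fst (id1 := 0) (op1 := +%R)) //= -sum1_size natr_sum.
    rewrite (big_morph snd (id1 := 0) (op1 := +%R)) //=.
    by apply: eq_bigr => c' _; rewrite mulr_sumr.
  have zM : (`|heavy_sketch v w| <= 88 * (L * size Psi) * (3 * M))%N.
    apply: leq_trans (absz_sum _ _) _.
    apply: (@leq_trans (\sum_i `|v i| * (3 * M)))%N.
      by apply: leq_sum => i _; rewrite abszM leq_mul // absz_heavy_coef.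
    rewrite -big_distrl /= normv leq_mul // leq_mul //; exact: sum_abs_bias.
  have zQ : (`|heavy_sketch v w| + size Psi < Q)%N.
    have mM : (size Psi <= M)%N by exact: leq_trans nM.
    apply: (@leq_ltn_trans ((264 * L + 1) * (M * M))); last first.
      by rewrite QE ltn_pmul2r // muln_gt0 M0.
    apply: leq_trans (leq_add zM (leqnn _)) _.
    have : (L * size Psi * M <= L * M * M)%N by rewrite !leq_mul.
    have : (size Psi <= M * M)%N by rewrite (leq_trans mM) // leq_pmull.
    by lia.
  by rewrite mod_testP //; lia.
have probE b : prob_answer R A Psi b
    = #|[pred w : W | (size Psi <= `|heavy_sketch v w|)%N == b]|%:R / #|{: W}|%:R.
  rewrite Aprob; congr (_%:R / _); apply: eq_card => w; by rewrite !inE ansE.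
have W0 : (0 < #|{: W}|)%N.
  by rewrite card_prod !card_ffun !card_ord muln_gt0 !expn_gt0.
pose P b := [pred w : W | (size Psi <= `|heavy_sketch v w|)%N == b].
have prob_ge b : (3 * #|P (~~ b)| <= #|{: W}|)%N -> 2 / 3 <= prob_answer R A Psi b.
  move=> le3; rewrite probE ler_pdivlMr ?ltr0n // -/(P b).
  have := cardC (P b).
  have -> : #|predC (P b)| = #|P (~~ b)|.
    by apply: eq_card => w; rewrite !inE; case: b {le3}; case: leqP.
  move: le3; move: #|P (~~ b)| #|P b| #|{: W}| => x y z le3 yx.
  have : (2 * z <= 3 * y)%N by lia.
  by rewrite -(ler_nat R) !natrM; lra.
have mM : (0 < size Psi <= M)%N by rewrite m0 (leq_trans md).
split=> le; apply: prob_ge.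
  have v_large : (44 * size Psi <= \sum_i `|v i|)%N by rewrite normv; lia.
  apply: leq_trans (heavy_sketch_large mM v_large); rewrite leq_mul2l /=.
  by apply: subset_leq_card; apply/fintype.subsetP => w; rewrite !inE ltnNge; case: leqP.
have v_small : (33 * (\sum_i `|v i|) <= size Psi)%N by rewrite normv; lia.
apply: leq_trans (heavy_sketch_small M0 m0 v_small); rewrite leq_mul2l /=.
by apply: subset_leq_card; apply/fintype.subsetP => w; rewrite !inE => /eqP.
Qed.

(** * Rounding by a biased product distribution *)

Lemma prod_1D_ge (R : realFieldType) (eta : R) (I : Type) (r : seq I) (a : I -> R) :
  0 <= eta <= 1 -> (forall i, `|a i| <= eta) ->
  1 + \sum_(i <- r) a i - 2 ^+ size r * eta ^+ 2 <= \prod_(i <- r) (1 + a i).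
Proof.
move=> /andP[eta0 eta1] a_le.
(* The induction also carries a first-order bound: one more factor adds [a i * (P - 1)] to the
   second-order error. *)
suff [_] : `|\prod_(i <- r) (1 + a i) - 1| <= (2 ^+ size r - 1) * eta /\
  `|\prod_(i <- r) (1 + a i) - 1 - \sum_(i <- r) a i| <= 2 ^+ size r * eta ^+ 2.
  by rewrite ler_norml; lra.
elim: r => [|i r [IH1 IH2]].
  by rewrite !big_nil !subrr normr0 expr0 mul0r mul1r sqr_ge0.
rewrite !big_cons /= exprS.
move: (\prod_(i <- r) _) (\sum_(i <- r) _) (2 ^+ size r) IH1 IH2 => P S N IH1 IH2.
have aP : `|a i * (P - 1)| <= eta * ((N - 1) * eta) by rewrite normrM ler_pM.
have aP' : eta * ((N - 1) * eta) <= (N - 1) * eta.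
  by rewrite ler_piMl //; exact: le_trans IH1.
split.
  rewrite (_ : _ - 1 = (P - 1) + (a i * (P - 1) + a i)); last by ring.
  apply: le_trans (ler_normD _ _) _; apply: le_trans (lerD IH1 (ler_normD _ _)) _.
  by have := a_le i; lra.
rewrite (_ : _ - _ = (P - 1 - S) + a i * (P - 1)); last by ring.
apply: le_trans (ler_normD _ _) _; apply: le_trans (lerD IH2 aP) _.
by have := sqr_ge0 eta; rewrite expr2; lra.
Qed.

Lemma sum_tuple_ffun (V : nmodType) (T : finType) (n : nat) (h : n.-tuple T -> V) :
  \sum_b h b = \sum_(g : {ffun 'I_n -> T}) h [tuple g i | i < n].
Proof.
apply: reindex; exists (fun b => finfun (tnth b)) => [g _|b _].
  by apply/ffunP => i; rewrite ffunE tnth_mktuple.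
by apply: eq_from_tnth => i; rewrite tnth_mktuple ffunE.
Qed.

Lemma constraint_var_inj (k n : nat) (c : constraint k n) :
  injective (fun t => (tnth (val c) t).1).
Proof.
have /tuple_uniqP inj : uniq [tuple of [seq l.1 | l <- val c]] by exact: (valP c).
by move=> t t' E; apply: inj; rewrite !tnth_map.
Qed.

(* The literals of a constraint are independent under a product distribution,
   since their variables are distinct. *)
Lemma product_marginal (R : realType) (k n : nat) (w : 'I_n -> bool -> R)
    (c : constraint k n) (F : k.-tuple bool -> R) :
  (forall i, \sum_b w i b = 1) ->
  \sum_(b : n.-tuple bool) (\prod_i w i (tnth b i)) * F (map_tuple (lit_val b) (val c))
  = \sum_x F x * \prod_t w (tnth (val c) t).1 (tnth x t (+) (tnth (val c) t).2).
Proof.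
move=> w1; pose var t := (tnth (val c) t).1; pose neg t := (tnth (val c) t).2.
pose agree (b : n.-tuple bool) (x : k.-tuple bool) t : R :=
  (tnth b (var t) (+) neg t == tnth x t)%:R.
have FE b : F (map_tuple (lit_val b) (val c)) = \sum_x F x * \prod_t agree b x t.
  rewrite (bigD1 (map_tuple (lit_val b) (val c))) //= big1 => [|t _]; last first.
    by rewrite /agree tnth_map eqxx.
  rewrite mulr1 big1 ?addr0 // => x neq; have [t neqt] : exists t, agree b x t = 0.
    apply: contrapT => /forallNP all1; case/eqP: neq; apply: eq_from_tnth => t.
    have := all1 t; rewrite /agree tnth_map /lit_val; case: eqP => [->//|_] [].
    by [].
  by rewrite (bigD1 t) //= neqt mul0r mulr0.
under eq_bigr do rewrite FE mulr_sumr.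
rewrite exchange_big; apply: eq_bigr => x _ /=.
under eq_bigr do rewrite mulrCA.
rewrite -mulr_sumr; congr (_ * _).
rewrite sum_tuple_ffun.
(* [H i] collects what depends on the variable [i]. At most one position reads it, so summing over
   [b] leaves one weight, or 1 if no position does. *)
pose H i (b : bool) : R := w i b * \prod_(t | var t == i) (b (+) neg t == tnth x t)%:R.
transitivity (\sum_(g : {ffun 'I_n -> bool}) \prod_i H i (g i)).
  apply: eq_bigr => g _; rewrite big_split /=; congr (_ * _).
    by apply: eq_bigr => i _; rewrite tnth_mktuple.
  rewrite (partition_big var xpredT) //=; apply: eq_bigr => i _.
  by apply: eq_bigr => t /eqP <-; rewrite /agree tnth_mktuple.
rewrite -bigA_distr_bigA [RHS](partition_big var xpredT) //=.
apply: eq_bigr => i _; rewrite /H.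
have [/existsP[t /eqP vt]|/existsPn no] := boolP [exists t, var t == i].
  have vE : (fun t' => var t' == i) =1 pred1 t.
    by move=> t' /=; rewrite -vt; apply/eqP/eqP => [/constraint_var_inj|->].
  rewrite [RHS](big_pred1 t) //; under eq_bigr do rewrite (big_pred1 t) //.
  rewrite big_bool /= -/(var t) vt -/(neg t).
  by case: (neg t); case: (tnth x t); rewrite /= !mulr0 !mulr1 ?addr0 ?add0r.
rewrite [RHS]big_pred0; last by move=> t; apply/negbTE.
rewrite -[RHS](w1 i); apply: eq_bigr => b _; rewrite big_pred0 ?mulr1 //.
by move=> t; apply/negbTE.
Qed.

Definition linear_form (k : nat) (lam : 'I_k -> int) (x : k.-tuple bool) : int :=
  \sum_t lam t * pm1 (tnth x t).

(** This is [2 ^ k] times the degree-one Fourier coefficient at [t]; without normalization it is an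
    integer, as the modular counters require. *)
Definition chow (k : nat) (f : predicate k) (t : 'I_k) : int :=
  \sum_(x : k.-tuple bool | f x) pm1 (tnth x t).

Lemma sum_bias_assignment (k n : nat) (lam : 'I_k -> int) (Psi : instance k n)
    (a : n.-tuple bool) :
  \sum_i bias lam Psi i * pm1 (tnth a i)
  = \sum_(c <- Psi) linear_form lam (map_tuple (lit_val a) (val c)).
Proof.
rewrite sum_bias; apply: eq_bigr => c _; apply: eq_bigr => t _.
rewrite tnth_map /lit_val /pm1 -mulrA; congr (_ * _).
by rewrite mulrC -signr_addb.
Qed.

Section Rounding.
Variables (R : realType) (k n : nat) (f : predicate k) (a : assignment n) (eta : R).
Hypothesis eta01 : 0 <= eta <= 1.

Definition biased (i : 'I_n) (b : bool) : R := (1 + eta * (-1) ^+ (tnth a i (+) b)) / 2.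

Lemma sum_biased i : \sum_b biased i b = 1.
Proof. by rewrite big_bool /biased; case: (tnth a i) => /=; lra. Qed.

Lemma biased_ge0 i b : 0 <= biased i b.
Proof.
by have /andP[eta0 eta1] := eta01; rewrite /biased; case: (_ (+) _) => /=; lra.
Qed.

Lemma card_sat_le : #|[pred x | f x]|%:R <= 2 ^+ k :> R.
Proof. by rewrite -natrX ler_nat -card_bool -card_tuple max_card. Qed.

(** First-order expansion of the product: the constants give [rho], the linear terms the form with
    weights [chow f]. The error [2 ^ k * eta ^ 2 / 2 ^ k] is paid by at most [2 ^ k] satisfying
    patterns. *)
Lemma rounding_constraint (c : constraint k n) :
  rho R f - 2 ^+ k * eta ^+ 2
    + eta / 2 ^+ k * (linear_form (chow f) (map_tuple (lit_val a) (val c)))%:~R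
  <= \sum_(b : n.-tuple bool) (\prod_i biased i (tnth b i)) * (satisfies f b c)%:R.
Proof.
rewrite (product_marginal c (fun x => (f x)%:R) sum_biased).
pose y := map_tuple (lit_val a) (val c); rewrite -/y.
pose z (x : k.-tuple bool) (t : 'I_k) : R := eta * (pm1 (tnth y t) * pm1 (tnth x t))%:~R.
have K0 : 0 < 2 ^+ k :> R by rewrite exprn_gt0.
have prodE x : \prod_t biased (tnth (val c) t).1 (tnth x t (+) (tnth (val c) t).2)
    = (\prod_t (1 + z x t)) / 2 ^+ k.
  have -> : 2 ^+ k = \prod_(t < k) 2 :> R by rewrite prodr_const card_ord.
  rewrite -prodf_div; apply: eq_bigr => t _.
  congr ((1 + eta * _) / 2); rewrite /y tnth_map /lit_val /pm1.
  by case: (tnth a _); case: (tnth x t); case: (tnth (val c) t).2.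
have prod_ge x : 1 + \sum_t z x t - 2 ^+ k * eta ^+ 2 <= \prod_t (1 + z x t).
  have := @prod_1D_ge R eta _ (index_enum 'I_k) (z x) eta01.
  rewrite [index_enum _]unlock -enumT size_enum_ord; apply => t.
  rewrite normrM ger0_norm; last by case/andP: eta01.
  by rewrite /pm1 -signr_addb; case: (_ (+) _); rewrite ?normrN normr1 mulr1.
apply: (@le_trans _ _ (\sum_(x | f x) (1 + \sum_t z x t - 2 ^+ k * eta ^+ 2) / 2 ^+ k)).
  rewrite -mulr_suml !big_split /= !sumr_const exchange_big /=.
  rewrite /rho card_classical_set -[X in _ <= X]/(_ * _).
  set s := #|_|; have := card_sat_le; rewrite -/s => sK.
  have -> : \sum_t \sum_(x | f x) z x t = eta * (linear_form (chow f) y)%:~R.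
    rewrite /linear_form rmorph_sum mulr_sumr; apply: eq_bigr => t _ /=.
    rewrite /z -mulr_sumr -rmorph_sum /= -mulr_sumr; congr (_ * _%:~R).
    by rewrite mulrC.
  set l := (linear_form _ _)%:~R; move: (2 ^+ k) K0 sK => N K0 sK.
  have -> : s%:R / N - N * eta ^+ 2 + eta / N * l
      = (s%:R + eta * l - N * eta ^+ 2 * N) / N by field; rewrite gt_eqF.
  rewrite ler_pM2r ?invr_gt0 // lerD2l mulNrn lerN2 -mulr_natr ler_wpM2l //.
  by rewrite mulr_ge0 ?sqr_ge0 // ltW.
rewrite big_mkcond; apply: ler_sum => x _ /=; rewrite prodE.
case: ifP => _; last by rewrite mul0r.
by rewrite mul1r ler_pM2r ?invr_gt0.
Qed.

(** The best assignment does at least as well as the average under the biased distribution. *)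
Lemma rounding (Psi : instance k n) : (0 < size Psi)%N ->
  (rho R f - 2 ^+ k * eta ^+ 2) * (size Psi)%:R
    + eta / 2 ^+ k * (\sum_(c <- Psi) linear_form (chow f) (map_tuple (lit_val a) (val c)))%:~R
  <= csp_val R f Psi * (size Psi)%:R.
Proof.
move=> m0; have m0R : 0 < (size Psi)%:R :> R by rewrite ltr0n.
pose mu (b : n.-tuple bool) := \prod_i biased i (tnth b i).
have mu_ge0 b : 0 <= mu b by apply: prodr_ge0 => i _; exact: biased_ge0.
have mu1 : \sum_b mu b = 1.
  transitivity (\prod_i \sum_b biased i b); last first.
    by rewrite big1 // => i _; exact: sum_biased.
  rewrite sum_tuple_ffun.
  rewrite bigA_distr_bigA; apply: eq_bigr => g _; apply: eq_bigr => i _.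
  by rewrite tnth_mktuple.
have countE (b : n.-tuple bool) :
    (count (satisfies f b) Psi)%:R = \sum_(c <- Psi) (satisfies f b c)%:R :> R.
  rewrite -sum1_count natr_sum big_mkcond; apply: eq_bigr => c _.
  by case: (satisfies f b c).
apply: (@le_trans _ _ (\sum_b mu b * (count (satisfies f b) Psi)%:R)).
  under [leRHS]eq_bigr do rewrite countE mulr_sumr.
  rewrite [leRHS]exchange_big /= rmorph_sum mulr_sumr /= mulr_natr.
  have sumC (x : R) : x *+ size Psi = \sum_(c <- Psi) x.
    by rewrite big_const_seq count_predT iter_addr_0.
  rewrite sumC -big_split /=.
  by apply: ler_sum => c _; exact: rounding_constraint.
rewrite -[leRHS]mul1r -[X in _ <= X * _]mu1 mulr_suml; apply: ler_sum => b _.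
rewrite ler_wpM2l // -ler_pdivrMr //.
exact: le_bigmax.
Qed.

End Rounding.

(** * Space bound and the Chow criterion *)

Lemma logspace_sketch_bits (R : realType) (d c : nat) : logspace R (sketch_bits d c).
Proof.
(* For l = [trunc_log 2 n] >= 1, the bound l + 1 <= 2 l leaves at most C l bits. Below, [C + 1]
   keeps the constant positive even if C = 0. *)
apply/eqO_exP; pose C : R := (2 * c + 8 * d)%:R.
have ln2 : 0 < ln 2 :> R by rewrite ln_gt0 // ltr1n.
exists ((C + 1) / ln 2); first by rewrite divr_gt0 // ltr_wpDl.
near=> n; have n2 : (2 <= n)%N by near: n; exact: nbhs_infty_ge.
pose l := trunc_log 2 n.
have l1 : (1 <= l)%N by rewrite trunc_log_gt0.
have ln_ge : l%:R * ln 2 <= ln n%:R :> R.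
  rewrite mulr_natl -lnXn // -natrX ler_ln ?posrE ?ltr0n ?expn_gt0 //; last by lia.
  by rewrite ler_nat trunc_logP //; lia.
rewrite !ger0_norm ?ln_ge0 ?ler1n ?ler0n //; try lia.
apply: (@le_trans _ _ (C * l%:R)).
  by rewrite -natrM ler_nat /sketch_bits -/l; nia.
apply: (@le_trans _ _ ((C + 1) / ln 2 * (l%:R * ln 2))).
  have -> : (C + 1) / ln 2 * (l%:R * ln 2) = (C + 1) * l%:R by field; rewrite gt_eqF.
  by rewrite ler_wpM2r // lerDl.
by rewrite ler_wpM2l // divr_ge0 ?addr_ge0 // ltW.
Unshelve. all: by end_near.
Qed.

Section Chow.
Variables (R : realType) (k : nat) (f : predicate k).
Let lam := chow f.
Let L := (\sum_t `|lam t|)%N.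

Lemma linear_form_ge (x : k.-tuple bool) : - L%:Z <= linear_form lam x.
Proof.
have := absz_sum (index_enum 'I_k) (fun t => lam t * pm1 (tnth x t)).
rewrite -/(linear_form lam x) (_ : (\sum_(_ <- _) _)%N = L); first by lia.
by apply: eq_bigr => t _; rewrite abszM absz_pm1 muln1.
Qed.

(** An integral form that is positive is at least 1, so each satisfied constraint contributes at
    least 1 and each other one at least -L. *)
Lemma norm_bias_ge (n : nat) (Psi : instance k n) (a : assignment n) :
  (forall x, f x -> 0 < linear_form lam x) ->
  ((count (satisfies f a) Psi)%:Z * (1 + L%:Z) - L%:Z * (size Psi)%:Z
    <= (\sum_i `|bias lam Psi i|)%N%:Z)%R.
Proof.
move=> f_pos; apply: (@le_trans _ _ (\sum_i bias lam Psi i * pm1 (tnth a i))).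
  rewrite sum_bias_assignment; elim: Psi => [|c Psi IH] /=.
    by rewrite big_nil; lia.
  rewrite big_cons; apply: le_trans (lerD (lexx _) IH).
  rewrite PoszD -[(size Psi).+1%:Z]/(1 + (size Psi)%:Z) [leLHS](_ : _ =
    ((satisfies f a c)%:Z * (1 + L%:Z) - L%:Z) + ((count (satisfies f a) Psi)%:Z
      * (1 + L%:Z) - L%:Z * (size Psi)%:Z)); last by ring.
  rewrite lerD2r.
  have := linear_form_ge (map_tuple (lit_val a) (val c)).
  have := f_pos (map_tuple (lit_val a) (val c)); rewrite -/(satisfies f a c).
  move: (linear_form lam _) => y; case: (satisfies f a c) => [/(_ isT)|_]; lia.
apply: (@le_trans _ _ `|\sum_i bias lam Psi i * pm1 (tnth a i)|); first exact: ler_norm.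
rewrite -abszE lez_nat; apply: leq_trans (absz_sum _ _) _.
by apply: leq_sum => i _; rewrite abszM absz_pm1 muln1.
Qed.

Lemma norm_bias_attained (n : nat) (Psi : instance k n) :
  exists a : assignment n, \sum_(c <- Psi) linear_form lam (map_tuple (lit_val a) (val c))
    = (\sum_i `|bias lam Psi i|)%N%:Z.
Proof.
exists [tuple bias lam Psi i < 0 | i < n]; rewrite -sum_bias_assignment.
rewrite (big_morph Posz PoszD (erefl _)); apply: eq_bigr => i _.
by rewrite tnth_mktuple abszE normrEsign mulrC.
Qed.

Lemma chow_sketching_approximable : (exists x, ~~ f x) ->
  (forall x, f x -> 0 < linear_form lam x) ->
  sketching_approximable R f (logspace R).
Proof.
move=> [x0 fx0] f_pos; pose N : R := 2 ^+ k; pose D : R := 2904.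
have N1 : 1 <= N by rewrite exprn_ege1 // ler1n.
have N0 : 0 < N by lra.
(* [eta] maximizes the rounding advantage [eta / (N D) - N eta^2], whose maximum is [gain]. *)
pose eta : R := 1 / (2 * D * N ^+ 2).
pose gain : R := 1 / (4 * D ^+ 2 * N ^+ 3).
(* Dividing by 1 + L lets [norm_bias_ge] turn value 1 - epsilon into norm at least (1 - gain) m >= m
   / 2. *)
pose epsilon := gain / (1 + L%:R).
have L1 : 1 <= 1 + L%:R :> R by rewrite lerDl.
have gain0 : 0 < gain by rewrite divr_gt0 // !mulr_gt0 // ?exprn_gt0 // /D; lra.
have gain_le : 4 * gain * N <= 1.
  rewrite [leRHS](_ : _ = 4 * gain * N * (D ^+ 2 * N ^+ 2)); last first.
    by rewrite /gain; field; rewrite gt_eqF //= /D; lra.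
  have DN : 1 <= D ^+ 2 * N ^+ 2 by rewrite -exprMn exprn_ege1 // /D; lra.
  by rewrite ler_peMr // (mulr_ge0 (mulr_ge0 _ (ltW gain0)) (ltW N0)).
have eta01 : 0 <= eta <= 1.
  have DN : 1 <= 2 * D * N ^+ 2 by have := exprn_ege1 2 N1; rewrite /D; lra.
  by rewrite divr_ge0 ?ler_pdivrMr ?mul1r //; lra.
have gainE : eta / N / D - N * eta ^+ 2 = gain.
  rewrite /eta /gain; field; rewrite gt_eqF //= /D; lra.
have eps0 : 0 < epsilon by rewrite divr_gt0 //; lra.
have eps_gain : epsilon <= gain by rewrite ler_pdivrMr ?ler_peMr //; lra.
have epsL : epsilon * (1 + L%:R) = gain by rewrite divfK // gt_eqF //; lra.
(* The falsifying [x0] keeps [rho] at distance 1 / N from 1, which leaves room for 2 epsilon <= 1 /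
   (2 N). *)
have rho_le : rho R f <= 1 - 1 / N.
  rewrite /rho card_classical_set -/N lerBrDr -mulrDl ler_pdivrMr // mul1r.
  rewrite natr1 /N -natrX ler_nat -card_bool -card_tuple.
  rewrite (cardD1 x0 {: k.-tuple bool}) ltnS; apply: subset_leq_card.
  apply/fintype.subsetP => x; rewrite !inE => fx; rewrite andbT.
  by apply: contraNneq fx0 => <-.
exists epsilon; first split=> //.
  have : gain <= 1 / N / 4 by rewrite !ler_pdivlMr //; lra.
  have : 0 < 1 / N by rewrite divr_gt0.
  by lra.
move=> d; pose c := (264 * L + 2)%N.
have cL : (264 * L + 1 < 2 ^ c)%N.
  by have := ltn_expl c (isT : 1 < 2)%N; move: (2 ^ c)%N => p; rewrite /c; lia.
exists (sketch_bits d c); first exact: logspace_sketch_bits.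
move=> n; have [A Acomp Aok] := @gap_norm_sketch R k n d c lam cL.
exists A => // Psi m_bounds; have /andP[m0 _] := m_bounds.
have [large small] := Aok Psi m_bounds.
have m0R : 0 < (size Psi)%:R :> R by rewrite ltr0n.
set V := (\sum_i `|bias lam Psi i|)%N in large small.
split=> val_f.
  apply: large.
  (* The default 0 of the maximum is below every fraction, so the maximum is attained. *)
  have [a aE] : exists a : assignment n,
      csp_val R f Psi = (count (satisfies f a) Psi)%:R / (size Psi)%:R.
    have := @bigmax_eq_arg _ R _ 0 (nseq_tuple n false) xpredT
      (fun a : n.-tuple bool => (count (satisfies f a) Psi)%:R / (size Psi)%:R) isT.
    by move=> maxE; rewrite /csp_val maxE; [eexists | move=> a _; rewrite divr_ge0].
  move: val_f; rewrite aE ler_pdivlMr // => val_f.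
  have := norm_bias_ge Psi a f_pos; rewrite -/V -(ler_int R) !(rmorphB, rmorphM, rmorphD) /=.
  rewrite -!pmulrn => V_ge; rewrite -(ler_nat R) natrM.
  move: (count _ _)%:R (size Psi)%:R L%:R V%:R val_f V_ge L1 m0R epsL => C m l v.
  move=> val_f V_ge L1' m0R' epsL'.
  have : (1 - epsilon) * m * (1 + l) <= C * (1 + l) by rewrite ler_wpM2r //; lra.
  have : epsilon * (1 + l) * m <= 1 / 2 * m by rewrite epsL' ler_wpM2r ?ltW //; nra.
  by lra.
(* Were the norm above m / D, rounding towards an assignment attaining it would give value at least
   rho + gain >= rho + epsilon. *)
apply: small; rewrite leqNgt; apply/negP => mV.
have [a aE] := norm_bias_attained Psi.
have := rounding f a eta01 m0; rewrite -/lam aE -/V -pmulrn -/N.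
have mV' : (size Psi)%:R <= D * V%:R by rewrite /D -natrM ler_nat ltnW.
move: (size Psi)%:R V%:R m0R mV' => m v m0R' mV'.
move=> /le_lt_trans/(_ (_ : _ < (rho R f + epsilon) * m)).
rewrite ltr_pM2r // => /(_ val_f).
have : eta / N / D * m <= eta / N * v.
  rewrite -[leLHS]mulrA (mulrC D^-1); apply: ler_wpM2l.
    by rewrite divr_ge0 ?(ltW N0) //; case/andP: eta01.
  by rewrite ler_pdivrMr 1?mulrC // /D; lra.
have : epsilon * m <= gain * m by apply: ler_wpM2r => //; exact: ltW.
rewrite -gainE; lra.
Qed.

End Chow.

(** * Chow coefficients of the weighted monarchy predicate *)

Lemma sum_tuple_cons (V : nmodType) (T : finType) (n : nat) (h : n.+1.-tuple T -> V) :
  \sum_x h x = \sum_b \sum_(y : n.-tuple T) h [tuple of b :: y].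
Proof.
rewrite pair_bigA; apply: reindex.
exists (fun x : n.+1.-tuple T => (thead x, [tuple of behead x])) => [[b y] _|x _] /=.
  by congr pair; apply: val_inj.
by rewrite [RHS](tuple_eta x); apply: val_inj.
Qed.

(** Since [true] encodes -1, this is the number of votes -1. *)
Definition weight (n : nat) (x : n.-tuple bool) : nat := count id x.

Lemma sum_weight (V : nmodType) (n : nat) (g : nat -> V) :
  \sum_(x : n.-tuple bool) g (weight x) = \sum_(i < n.+1) g i *+ 'C(n, i).
Proof.
elim: n g => [|n IH] g.
  rewrite big_ord1 bin0 (bigD1 [tuple]) //= big1 ?addr0 // => x.
  by case/eqP; exact: tuple0.
rewrite sum_tuple_cons big_bool /=.
under eq_bigr do rewrite /weight /= add1n -/(weight _).
under [X in _ + X]eq_bigr do rewrite /weight /= add0n -/(weight _).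
rewrite (IH (fun i => g i.+1)) (IH g).
rewrite [RHS]big_ord_recl bin0.
under [X in _ = _ + X]eq_bigr do rewrite lift0 binS mulrnDr.
rewrite big_split /= [X in _ + X = _]big_ord_recl.
rewrite [X in _ = _ + (X + _)]big_ord_recr /= (bin_small (ltnSn n)) mulr0n addr0 bin0.
by rewrite [LHS]addrC -addrA.
Qed.

Lemma sum_pm1 (n : nat) (x : n.-tuple bool) :
  \sum_(i < n) pm1 (tnth x i) = n%:Z - 2 * (weight x)%:Z.
Proof.
elim: n x => [|n IH] x; first by rewrite big_ord0 tuple0.
rewrite (tuple_eta x) big_ord_recl tnth0 /weight /=.
under eq_bigr do rewrite tnthS.
by rewrite IH /weight /=; case: (thead x); rewrite /pm1 /=; lia.
Qed.

(** The two values of bit [t] enter with opposite signs, leaving a discrete derivative. [front]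
    treats the first bit; for later ones the first bit is peeled off. *)
Lemma sum_weight_pm1 (n : nat) (g : nat -> int) (t : 'I_n.+1) :
  \sum_(y : n.+1.-tuple bool) g (weight y) * pm1 (tnth y t)
  = \sum_(z : n.-tuple bool) (g (weight z) - g (weight z).+1).
Proof.
have front m (g' : nat -> int) :
    \sum_(y : m.+1.-tuple bool) g' (weight y) * pm1 (tnth y ord0)
    = \sum_(z : m.-tuple bool) (g' (weight z) - g' (weight z).+1).
  rewrite sum_tuple_cons big_bool /= -big_split; apply: eq_bigr => z _.
  by rewrite /weight /= tnth0 add1n add0n /pm1 /=; lia.
elim: n g t => [|n IH] g t; have [t' ->|->] := unliftP ord0 t; try exact: front.
  by case: t'.
rewrite !sum_tuple_cons !big_bool /=; congr (_ + _).
  under eq_bigr do rewrite tnthS /weight /= add1n -/(weight _).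
  by rewrite (IH (fun i => g i.+1)).
under eq_bigr do rewrite tnthS /weight /= add0n -/(weight _).
by rewrite IH.
Qed.

Section Monarchy.
Variables (n j H : nat).
Hypothesis nj : (n + j = 2 * H)%N.

(* With [k = n + 2] variables, the constraint holds if and only if fewer than [cutoff b]
   of the non-monarchs are -1, where [b] is the vote of the monarch. *)
Definition cutoff (b : bool) : nat := if b then (H.+1 - j)%N else H.+1.

Hypothesis jH : (j <= H)%N.

(** By n + j = 2 H the weighted sum is 2 H + 1 - 2 [weight y], less 2 j if the monarch votes -1. It
    is odd, so there are no ties. *)
Lemma WMON_cons (b : bool) (y : n.+1.-tuple bool) :
  WMON n.+2 j%:Z [tuple of b :: y] = (weight y < cutoff b)%N.
Proof.
rewrite /WMON /= big_add1 /= big_mkord.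
under eq_bigr do rewrite -tnth_nth.
rewrite sum_pm1 /cutoff.
by case: b; rewrite /pm1 /=; apply/idP/idP; lia.
Qed.

Let f : predicate n.+2 := WMON n.+2 j%:Z.

Lemma chow_cons (t : 'I_n.+2) : chow f t
  = \sum_b \sum_(y : n.+1.-tuple bool)
      (weight y < cutoff b)%N%:Z * pm1 (tnth [tuple of b :: y] t).
Proof.
rewrite /chow big_mkcond sum_tuple_cons; apply: eq_bigr => b _.
apply: eq_bigr => y _; rewrite /f WMON_cons.
by case: ifP => _; rewrite ?mul1r ?mul0r.
Qed.

(** The monarch is pivotal exactly when the number of -1 among the others lies between the two
    cutoffs. *)
Lemma chow_monarch : chow f ord0 = (\sum_(H.+1 - j <= i < H.+1) 'C(n.+1, i))%N%:Z.
Proof.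
rewrite chow_cons big_bool /= /pm1.
under eq_bigr do rewrite tnth0 /=.
under [X in _ + X]eq_bigr do rewrite tnth0 /=.
rewrite -big_split /=.
under eq_bigr do rewrite mulrN1 mulr1 addrC.
rewrite (sum_weight _ (fun i => (i < H.+1)%N%:Z - (i < H.+1 - j)%N%:Z)).
rewrite (big_morph Posz PoszD (erefl _)).
rewrite -(big_mkord xpredT (fun i => ((i < H.+1)%N%:Z - (i < H.+1 - j)%N%:Z) *+ 'C(n.+1, i))).
rewrite (big_cat_nat (n := (H.+1 - j)%N)) //=; last by lia.
rewrite big_nat big1 ?add0r => [|i /andP[_ iH]]; last first.
  by rewrite iH (leq_trans iH) ?leq_subr // subrr mul0rn.
rewrite (big_cat_nat (n := H.+1)) /=; [|lia|lia].
rewrite [X in _ + X]big_nat [X in _ + X]big1 ?addr0 => [|i /andP[iH _]]; last first.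
  by rewrite ltnNge iH ltnNge (leq_trans _ iH) ?leq_subr // subrr mul0rn.
apply: eq_big_nat => i /andP[i1 i2].
by rewrite i2 ltnNge i1 subr0 pmulrn intz.
Qed.

(** A subject is pivotal when the other subjects have weight H, or H - j under a monarch voting -1;
    as H - j = n - H, both binomials agree. *)
Lemma chow_subject (t : 'I_n.+1) : chow f (lift ord0 t) = 2 * 'C(n, H)%:Z.
Proof.
rewrite chow_cons big_bool /=.
under eq_bigr do rewrite tnthS.
under [X in _ + X]eq_bigr do rewrite tnthS.
rewrite !(sum_weight_pm1 (fun i => (i < _)%N%:Z)).
have cutE m : \sum_(z : n.-tuple bool) ((weight z < m.+1)%N%:Z - ((weight z).+1 < m.+1)%N%:Z)
    = 'C(n, m)%:Z.
  rewrite (sum_weight _ (fun i => (i < m.+1)%N%:Z - (i.+1 < m.+1)%N%:Z)).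
  have [mn|nm] := leqP m n; last first.
    rewrite bin_small // big1 // => i _.
    have -> : (i < m.+1)%N by have := ltn_ord i; lia.
    have -> : (i.+1 < m.+1)%N by have := ltn_ord i; lia.
    by rewrite subrr mul0rn.
  rewrite (bigD1 (inord m)) //= inordK // ltnSn ltnn subr0 big1 ?addr0.
    by rewrite pmulrn intz.
  move=> i /eqP im; have {}im : i <> m :> nat.
    by move=> E; apply: im; apply: val_inj; rewrite /= inordK.
  have -> : (i.+1 < m.+1)%N = (i < m.+1)%N by lia.
  by rewrite subrr mul0rn.
rewrite /cutoff subSn // !cutE.
have -> : (H - j = n - H)%N by lia.
rewrite bin_sub; [lia|lia].
Qed.

End Monarchy.

(** * Near-constancy of the central binomials *)

Section Binomials.
Variables (n j H : nat).
Hypotheses (nj : (n + j = 2 * H)%N) (jH : (j <= H)%N) (j0 : (0 < j)%N).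

Lemma bin_step (s : nat) : (s < j)%N ->
  ('C(n, H - s.+1) * (H - j + s.+1) = (H - s) * 'C(n, H - s))%N.
Proof.
move=> sj; have := mul_bin_left n (H - s.+1)%N.
have -> : ((H - s.+1).+1 = H - s)%N by lia.
by have -> : (n - (H - s.+1) = H - j + s.+1)%N; lia.
Qed.

(* The window [H - j, H] is symmetric about [n / 2], so its ends carry its least binomials. *)
Lemma bin_window_ge (s : nat) : (s <= j)%N -> ('C(n, H) <= 'C(n, H - s))%N.
Proof.
have half s' : (2 * s' <= j)%N -> ('C(n, H) <= 'C(n, H - s'))%N.
  elim: s' => [|s' IH] sj; first by rewrite subn0.
  apply: leq_trans (IH _) _; first by lia.
  have := @bin_step s' ltac:(lia).
  move: 'C(n, H - s'.+1) 'C(n, H - s') => x y E.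
  have : ((H - j + s'.+1) * y <= (H - s') * y)%N by rewrite leq_mul2r; apply/orP; right; lia.
  by rewrite -E mulnC leq_pmul2r //; lia.
move=> sj; have [/half //|js] := leqP (2 * s) j.
rewrite -[in leqRHS]bin_sub; last by lia.
have -> : (n - (H - s) = H - (j - s))%N by lia.
by apply: half; lia.
Qed.

(** Each step multiplies the binomial by at most H / (H - p), where p = j - 1. The steps accumulate
    by the Bernoulli-type inequality (H - p) (H - s p) >= H (H - (s + 1) p). *)
Lemma bin_window_le (s : nat) : (s <= j)%N -> (j * j.-1 <= H)%N ->
  ('C(n, H - s) * (H - s * j.-1) <= 'C(n, H) * H)%N.
Proof.
move=> sj jjH; elim: s sj => [|s IH] sj; first by rewrite mul0n !subn0.
have {}IH := IH (ltnW sj); have := bin_step sj.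
have sjH : (s.+1 * j.-1 <= H)%N by rewrite (leq_trans _ jjH) // leq_mul2r sj orbT.
have H0 : (0 < H)%N by lia.
move: 'C(n, H - s.+1) 'C(n, H - s) 'C(n, H) IH => x y z IH E.
rewrite -(leq_pmul2r H0).
apply: (@leq_trans (x * (H - j.-1) * (H - s * j.-1))).
  rewrite -!mulnA leq_mul2l; apply/orP; right.
  move: sjH; rewrite mulSn; move: (j.-1) => p /subnK <-; set u := (H - _)%N.
  rewrite addnK (_ : _ - p = u + s * p)%N; last by lia.
  rewrite (_ : _ - s * p = u + p)%N; last by lia.
  by rewrite mulnDl !mulnDr; move: (s * p)%N => q; lia.
apply: (@leq_trans (H * y * (H - s * j.-1))).
  rewrite leq_mul2r; apply/orP; right.
  apply: (@leq_trans (x * (H - j + s.+1))); first by rewrite leq_mul2l; apply/orP; right; lia.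
  by rewrite E leq_mul2r leq_subr orbT.
by rewrite -mulnA mulnC leq_mul2r IH orbT.
Qed.

Let chow0 := (\sum_(H.+1 - j <= i < H.+1) 'C(n.+1, i))%N.

Lemma chow0_sum : chow0 = (\sum_(s < j) ('C(n, H - s) + 'C(n, H - s.+1)))%N.
Proof.
rewrite /chow0 big_nat_rev /= -{1}(add0n (H.+1 - j)%N) big_addn big_mkord.
have -> : (H.+1 - (H.+1 - j) = j)%N by lia.
apply: eq_bigr => s _; have sj := ltn_ord s.
have -> : (H.+1 - j + H.+1 - (s + (H.+1 - j)).+1 = (H - s.+1).+1)%N by lia.
by rewrite binS; congr ('C(_, _) + _)%N; lia.
Qed.

Lemma chow0_ge : (j * (2 * 'C(n, H)) <= chow0)%N.
Proof.
rewrite chow0_sum -{1}(card_ord j) -sum_nat_const; apply: leq_sum => s _.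
have := bin_window_ge (ltn_ord s); have := bin_window_ge (ltnW (ltn_ord s)); lia.
Qed.

Lemma chow0_lt : (j.+1 * j * j.-1 < H)%N -> (chow0 < j.+1 * (2 * 'C(n, H)))%N.
Proof.
move=> jjH; have jjH' : (j * j.-1 <= H)%N by nia.
have T0 : (0 < 'C(n, H))%N by rewrite bin_gt0; lia.
have le : (chow0 * (H - j * j.-1) <= j * (2 * ('C(n, H) * H)))%N.
  rewrite chow0_sum big_distrl; set X := (2 * _)%N.
  have -> : (j * X = \sum_(s < j) X)%N by rewrite sum_nat_const card_ord.
  apply: leq_sum => s _ /=; rewrite {}/X.
  have win s' : (s' <= j)%N -> ('C(n, H - s') * (H - j * j.-1) <= 'C(n, H) * H)%N.
    move=> sj; apply: leq_trans (bin_window_le sj jjH'); rewrite leq_mul2l leq_sub2l ?orbT //.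
    by rewrite leq_mul2r sj orbT.
  have := win _ (ltn_ord s); have := win _ (ltnW (ltn_ord s)); rewrite mulnDl; lia.
(* The assumption on H amounts to (j + 1) (H - j (j - 1)) > j H, which contradicts [le] combined
   with [ge]. *)
rewrite ltnNge; apply/negP => ge.
have : (j.+1 * (2 * 'C(n, H)) * (H - j * j.-1) <= j * (2 * ('C(n, H) * H)))%N.
  by apply: leq_trans le; rewrite leq_mul2r ge orbT.
have -> : (j * (2 * ('C(n, H) * H)) = 2 * 'C(n, H) * (j * H))%N by lia.
have -> : (j.+1 * (2 * 'C(n, H)) * (H - j * j.-1)
  = 2 * 'C(n, H) * (j.+1 * (H - j * j.-1)))%N by lia.
by rewrite leq_pmul2l ?muln_gt0 // mulnBr; lia.
Qed.

(** Let l1 = 2 'C(n, H) and let l0 be the weight of the monarch. Under a monarch voting -1 the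
    subjects sum to at least j + 1, and l0 < (j + 1) l1; otherwise they sum to at least 1 - j, and
    l0 >= j l1. *)
Lemma WMON_linear_form_gt0 (x : n.+2.-tuple bool) : (j.+1 * j * j.-1 < H)%N ->
  WMON n.+2 j%:Z x -> 0 < linear_form (chow (WMON n.+2 j%:Z)) x.
Proof.
move=> jjH.
have [b [y ->]] : exists b (y : n.+1.-tuple bool), x = [tuple of b :: y].
  by exists (thead x), [tuple of behead x]; rewrite [LHS](tuple_eta x); apply: val_inj.
rewrite (WMON_cons nj jH) /linear_form big_ord_recl tnth0 (chow_monarch nj jH).
rewrite (eq_bigr (fun i => 2 * 'C(n, H)%:Z * pm1 (tnth y i))) => [|i _]; last first.
  by rewrite tnthS; congr (_ * _); exact: (chow_subject nj jH).
rewrite -mulr_sumr sum_pm1 => yb.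
have T0 : (0 < 'C(n, H))%N by rewrite bin_gt0; lia.
move: yb chow0_ge (chow0_lt jjH); rewrite -/chow0 /cutoff.
move: 'C(n, H) T0 chow0 => T T0 l yb ge lt.
case: b yb => /= yb; rewrite /pm1 /=.
  have yE : (2 * weight y + (j.+1) <= n.+1)%N by lia.
  have : 2 * T%:Z * (j.+1)%:Z <= 2 * T%:Z * (n.+1%:Z - 2 * (weight y)%:Z).
    by rewrite ler_wpM2l //; lia.
  by lia.
have : 2 * T%:Z * (1 - j%:Z) <= 2 * T%:Z * (n.+1%:Z - 2 * (weight y)%:Z).
  by rewrite ler_wpM2l //; lia.
by lia.
Qed.

End Binomials.

(** * Choice of parameters *)

Lemma WMON_approximable (R : realType) (j k : nat) :
  (2 <= j)%N -> (7 * j ^ 3 <= k)%N -> ~~ odd (k + j) ->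
  sketching_approximable R (WMON k j%:Z) (logspace R).
Proof.
move=> j2 jk even_kj.
have j3 : (4 * j <= j ^ 3)%N by rewrite !expnS expn0; nia.
have kE : (k = (k - 2).+2)%N by lia.
move: even_kj jk; rewrite kE; move: (k - 2)%N => n even_kj jk.
pose H := (n + j)./2.
have nj : (n + j = 2 * H)%N by rewrite /H; lia.
have jH : (j <= H)%N by lia.
have jjH : (j.+1 * j * j.-1 < H)%N.
  have : (j.+1 * j * j.-1 <= j ^ 3)%N.
    by rewrite !expnS expn0 muln1; case: (j) j2 => // p _ /=; nia.
  by lia.
apply: chow_sketching_approximable; last by move=> x; apply: (WMON_linear_form_gt0 nj jH); lia.
(* The unanimous vote -1 falsifies the predicate. *)
exists [tuple of true :: nseq_tuple n.+1 true].
rewrite (WMON_cons nj jH) /cutoff /weight /= add1n count_nseq; lia.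
Qed.

Theorem theorem1p6 (R : realType) :
  (forall j k : nat, (2 <= j)%N -> (7 * j ^ 3 <= k)%N -> ~~ odd (k + j) ->
     sketching_approximable R (WMON k j%:Z) (logspace R)) /\
  (forall j : nat, (2 <= j)%N ->
     infinite_set [set k : nat | (2 <= k)%N /\
       sketching_approximable R (WMON k j%:Z) (logspace R)]).
Proof.
split=> [j k|j j2]; first exact: WMON_approximable.
apply/infiniteP.
(* Doubling the bound and adding j makes [F i + j] even. *)
pose F i := (7 * j ^ 3 * 2 + j + 2 * i)%N.
have F_inj : injective F by move=> i i'; rewrite /F; lia.
apply/card_subP; exists (range F); first by apply: inj_card_eq => i i' _ _ /F_inj.
have j3 : (0 < j ^ 3)%N by rewrite expn_gt0; lia.
move=> _ [i _ <-]; rewrite /F; split=> /=; first by lia.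
by apply: WMON_approximable => //; lia.
Qed.
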